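(* For every integer $v>2$, the number $I(v)$ of isomorphism classes of imbricated Finite Fractal Hyper-Trees on $v$ vertices is $$I(v)=\sum_{\lambda\in\mathcal{P}(v)}\ \prod_{s}\binom{f(s)+m_s-1}{m_s},$$ where: - $\mathcal{P}(v)$ is the set of all integer partitions $\lambda=(v_1,\dots,v_K)$ of $v$, written in descending order $v_1\ge v_2\ge\dots\ge v_K$, with $\sum_{k=1}^K v_k=v$, $v_1>1$ and $0<v_k<v$ for all $k$; - for each $\lambda$, the product runs over the distinct part sizes $s$ occurring among $v_1,\dots,v_K$; - $m_s$ is the multiplicity of $s$ in $\lambda$ (the number of parts equal to $s$); - $f(s)=S(s)+I(s)$ is the total number of isomorphism classes of Finite Fractal Hyper-Trees (FHTs) on $s$ vertices.
   Context: A hypergraph $H=(V,E)$ consists of a finite non-empty vertex set $V$ and a set $E$ of non-empty subsets of $V$ (hyperedges). Two hypergraphs are isomorphic if there is a bijection between their vertex sets carrying the collection of hyperedges of one exactly onto that of the other. Connectedness is edge-path connectedness: for all $x,y\in V$ there is a sequence of hyperedges $e_1,\dots,e_r$ ($r\ge 1$) with $x\in e_1$, $y\in e_r$ and $e_j\cap e_{j+1}\ne\emptyset$ for all $1\le j<r$. A hypergraph is Sperner if no hyperedge is contained in another distinct hyperedge. Sum of disjoint hypergraphs: for hypergraphs $H_i=(V_i,E_i)$, $i=1,\dots,m$, with pairwise disjoint vertex sets, $\sum_{i=1}^m H_i=(V,E)$ with $V=\bigcup_i V_i$ and $E=\big(\bigcup_i E_i\big)\cup\{V\}\setminus\{\{x\}\mid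 x\in V\}$. For enumeration purposes, the FHTs on $v$ vertices are hypergraphs (considered up to isomorphism) that are divided into two disjoint categories, defined recursively on $v$: - Flat structures: the connected Sperner hypergraphs on $v$ vertices. $S(v)$ is the number of their isomorphism classes. For $v=1$ the only one is $(\{1\},\{\{1\}\})$, and $S(1)=1$. - Imbricated structures (for $v>2$): the hypergraphs on $v$ vertices of the form $\sum_{k=1}^K\mathcal{F}_k$, where the $\mathcal{F}_k$ are FHTs (flat or imbricated) with pairwise disjoint vertex sets of sizes $v_1\ge\dots\ge v_K$ such that $\sum_k v_k=v$, $v_1>1$ and $0<v_k<v$ for all $k$. $I(v)$ is the number of their isomorphism classes, and $I(1)=I(2)=0$. Set $f(v)=S(v)+I(v)$. *)

(* Defs.v *)
From HB Require Import structures.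
From mathcomp Require Import all_boot.
From mathcomp Require Import boolp.

Set Implicit Arguments.
Unset Strict Implicit.
Unset Printing Implicit Defensive.

(* A hypergraph lives inside an ambient finite type [T]: its vertex set is a
   subset of [T], so that disjoint hypergraphs and their sum share one type. *)
Definition is_hypergraph (T : finType) (G : {set T} * {set {set T}}) : bool :=
  (G.1 != set0) && [forall e in G.2, (e != set0) && (e \subset G.1)].

Record hypergraph (T : finType) : Type := Hypergraph {
  hgval : {set T} * {set {set T}};
  hgvalP : is_hypergraph hgval }.

HB.instance Definition _ (T : finType) := [isSub for @hgval T].
HB.instance Definition _ (T : finType) := [Finite of hypergraph T by <:].

Definition hverts (T : finType) (H : hypergraph T) : {set T} := (hgval H).1.
Definition hedges (T : finType) (H : hypergraph T) : {set {set T}} :=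
  (hgval H).2.

(* A bijection [hverts G -> hverts H] is represented by a total function that
   is injective on [hverts G] with image [hverts H]; its values outside
   [hverts G] are irrelevant, since hyperedges are included in [hverts G]. *)
Definition hiso (T T' : finType) (G : hypergraph T) (H : hypergraph T') : Prop :=
  exists f : T -> T',
    [/\ {in hverts G &, injective f},
        f @: hverts G = hverts H
      & [set f @: (e : {set T}) | e in hedges G] = hedges H].

Definition connected (T : finType) (H : hypergraph T) : Prop :=
  forall x y, x \in hverts H -> y \in hverts H ->
  exists (e : {set T}) (p : seq {set T}),
    [/\ {subset e :: p <= hedges H}, x \in e, y \in last e p
      & path (fun a b : {set T} => a :&: b != set0) e p].

Definition sperner (T : finType) (H : hypergraph T) : Prop :=
  forall e e', e \in hedges H -> e' \in hedges H -> e \subset e' -> e = e'.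

Definition flat (T : finType) (H : hypergraph T) : Prop :=
  connected H /\ sperner H.

Definition hsum_verts (T : finType) (K : nat) (F : 'I_K.+1 -> hypergraph T) :
    {set T} :=
  \bigcup_k hverts (F k).

Definition hsum_edges (T : finType) (K : nat) (F : 'I_K.+1 -> hypergraph T) :
    {set {set T}} :=
  ((\bigcup_k hedges (F k)) :|: [set hsum_verts F])
    :\: [set [set x] | x in hsum_verts F].

Lemma hsumP (T : finType) (K : nat) (F : 'I_K.+1 -> hypergraph T) :
  is_hypergraph (hsum_verts F, hsum_edges F).
Proof.
have V0 : hsum_verts F != set0.
  have /andP[/set0Pn[x xV] _] := hgvalP (F ord0).
  by apply/set0Pn; exists x; apply/bigcupP; exists ord0.
rewrite /is_hypergraph V0 /=; apply/forall_inP => e /setDP[+ _].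
case/setUP => [/bigcupP[k _ ek]|/set1P->]; last by rewrite V0 /=.
have /andP[_ /forall_inP/(_ e ek)/andP[-> eV]] := hgvalP (F k).
by apply: (subset_trans eV); apply: (bigcup_sup k).
Qed.

Definition hsum (T : finType) (K : nat) (F : 'I_K.+1 -> hypergraph T) :
    hypergraph T :=
  Hypergraph (hsumP F).

Definition proper_partition (v : nat) (s : seq nat) : bool :=
  [&& sorted geq s, sumn s == v, 1 < head 0 s & all (fun w => 0 < w < v) s].

Inductive fht (T : finType) : hypergraph T -> Prop :=
| FlatFHT (H : hypergraph T) : flat H -> fht H
| ImbricatedFHT (H : hypergraph T) : imbricated H -> fht H
with imbricated (T : finType) : hypergraph T -> Prop :=
| Imbricated (v K : nat) (F : 'I_K.+1 -> hypergraph T) :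
    2 < v ->
    (forall k, fht (F k)) ->
    (forall i j, i != j -> [disjoint hverts (F i) & hverts (F j)]) ->
    proper_partition v [seq #|hverts (F k)| | k <- enum 'I_K.+1] ->
    imbricated (hsum F).

Lemma hiso_refl (T : finType) (G : hypergraph T) : hiso G G.
Proof.
exists id; split=> //; first exact: imset_id.
by rewrite -[RHS]imset_id; apply: eq_imset => e; rewrite imset_id.
Qed.

Lemma hiso_sym (T T' : finType) (G : hypergraph T) (H : hypergraph T') :
  hiso G H -> hiso H G.
Proof.
case=> f [fI fV fE]; have /andP[/set0Pn[x0 _] /forall_inP GE] := hgvalP G.
pose g y := odflt x0 [pick x in hverts G | f x == y].
have fK : {in hverts G, cancel f g}.
  move=> x xV; rewrite /g; case: pickP => [z /andP[zV /eqP] | /(_ x)] /=.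
    exact: fI.
  by rewrite xV eqxx.
have gfE (A : {set T}) : A \subset hverts G -> g @: (f @: A) = A.
  move=> /subsetP AV; rewrite -imset_comp -[RHS]imset_id.
  by apply: eq_in_imset => x /AV /fK.
exists g; split; rewrite -?fV -?fE.
- by move=> _ _ /imsetP[x xV ->] /imsetP[y yV ->]; rewrite !fK // => ->.
- exact: gfE.
- rewrite -imset_comp -[RHS]imset_id; apply: eq_in_imset => e /GE/andP[_ eV].
  exact: gfE.
Qed.

Lemma hiso_trans (T T' T'' : finType)
    (G : hypergraph T) (H : hypergraph T') (K : hypergraph T'') :
  hiso G H -> hiso H K -> hiso G K.
Proof.
case=> f [fI fV fE] [g [gI gV gE]]; exists (g \o f); split.
- move=> x y xV yV /= /gI; rewrite -fV => /(_ _ _)/fI; apply=> //; exact: imset_f.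
- by rewrite imset_comp fV.
- by rewrite -gE -fE -imset_comp; apply: eq_imset => e; rewrite /= imset_comp.
Qed.

Lemma hiso_ord (T : finType) (G : hypergraph T) (v : nat) :
  #|hverts G| = v ->
  exists2 H : hypergraph 'I_v, hverts H = [set: 'I_v] & hiso G H.
Proof.
move=> <-; have /andP[/set0Pn[x0 x0V] /forall_inP GE] := hgvalP G.
pose f := enum_rank_in (x0V : x0 \in hverts G).
have fV : f @: hverts G = [set: 'I_#|hverts G|].
  apply/setP => i; rewrite inE; apply/imsetP; exists (enum_val i).
    exact: enum_valP.
  by rewrite /f enum_valK_in.
have HP : is_hypergraph
    ([set: 'I_#|hverts G|], [set f @: (e : {set T}) | e in hedges G]).
  rewrite /is_hypergraph -fV imset_eq0; apply/andP; split.
    by apply/set0Pn; exists x0.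
  apply/forall_inP => _ /imsetP[e /GE/andP[e0 eV] ->].
  by rewrite imset_eq0 e0 imsetS.
by exists (Hypergraph HP) => //; exists f; split=> //; exact: enum_rank_in_inj.
Qed.

(* By [hiso_ord], every isomorphism class of hypergraphs on [v] vertices has a
   representative with vertex set the whole of ['I_v]. *)
Definition num_classes (v : nat) (P : hypergraph 'I_v -> Prop) : nat :=
  #|equivalence_partition (fun G H : hypergraph 'I_v => `[< hiso G H >])
      [set H : hypergraph 'I_v | (hverts H == [set: 'I_v]) && `[< P H >]]|.

Definition num_flat (v : nat) : nat := num_classes (@flat 'I_v).

Definition num_imbricated (v : nat) : nat := num_classes (@imbricated 'I_v).

Definition num_fht (v : nat) : nat := num_flat v + num_imbricated v.

(* Every integer partition of [v] has at most [v] parts, each at most [v], so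
   bounded sequences over ['I_v.+1] enumerate each of them exactly once. *)
Definition parts (v : nat) (l : v.-bseq 'I_v.+1) : seq nat :=
  [seq nat_of_ord w | w <- l].

(* Main.v *)
Require Import Defs.
From HB Require Import structures.
From mathcomp Require Import all_boot.
From mathcomp Require Import perm.
From mathcomp Require Import boolp.

(** An imbricated structure is determined up to isomorphism by the multiset of
    isomorphism classes of its summands, and every multiset of classes of FHTs
    whose sizes form a proper partition of [v] occurs. Counting imbricated
    structures is therefore counting such multisets: for a fixed partition, the
    summands of size [s] form a multiset of [m_s] elements among [f(s)] classes,
    chosen independently for each [s].

    The heart of the matter is that the summands can be recovered from the sum
    ([decomposition_unique]). An FHT is connected, and if it has at least two
    vertices then none of its hyperedges is a singleton, so that none is lost in
    the sum. Hence the vertex sets of the summands are the connected components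
    left in the sum when the hyperedge made of all vertices is removed, and a
    summand consists of the hyperedges inside its component. A vertex outside
    all remaining hyperedges is a summand of size one, the only hyperedge of
    which is that vertex. Conversely, isomorphisms of the summands glue to an
    isomorphism of the sums ([hiso_hsum]); together this gives [hiso_hsumP].
    All multisets occur because disjoint copies of given FHTs can be placed in a
    product type and transported back to ['I_v] ([decomposition_exists]).

    Finally [f(s)] is a sum because no imbricated structure is flat: the
    hyperedge of all vertices strictly contains another one
    ([imbricated_not_flat]). The binomial coefficients come from
    [card_coloured_multisets]. Classes of all sizes [s <= v] are represented
    within the single finite type [hypergraph 'I_v] by a choice of
    representatives ([rep], [num_fht_rep]), so that a multiset of classes is a
    function from that type to multiplicities. *)

Set Implicit Arguments.
Unset Strict Implicit.
Unset Printing Implicit Defensive.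

(** * Images of hypergraphs *)

Lemma hypergraph_eq (T : finType) (G H : hypergraph T) :
  hverts G = hverts H -> hedges G = hedges H -> G = H.
Proof.
move=> eqV eqE; apply: val_inj.
by rewrite [val G]surjective_pairing [val H]surjective_pairing; congr pair.
Qed.

Lemma hverts_neq0 (T : finType) (G : hypergraph T) : hverts G != set0.
Proof. by have /andP[] := hgvalP G. Qed.

Lemma hedge_neq0 (T : finType) (G : hypergraph T) e :
  e \in hedges G -> e != set0.
Proof. by have /andP[_ /forall_inP GE] := hgvalP G => /GE/andP[]. Qed.

Lemma hedge_sub (T : finType) (G : hypergraph T) e :
  e \in hedges G -> e \subset hverts G.
Proof. by have /andP[_ /forall_inP GE] := hgvalP G => /GE/andP[]. Qed.

Lemma hmapP (T T' : finType) (f : T -> T') (G : hypergraph T) :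
  is_hypergraph (f @: hverts G, [set f @: (e : {set T}) | e in hedges G]).
Proof.
rewrite /is_hypergraph imset_eq0 hverts_neq0 /=.
apply/forall_inP => _ /imsetP[e eG ->].
by rewrite imset_eq0 (hedge_neq0 eG) imsetS // hedge_sub.
Qed.

(** Isomorphic hypergraphs are the images of one another by injective maps
    ([hisoP]), which turns isomorphisms into equalities. *)
Definition hmap (T T' : finType) (f : T -> T') (G : hypergraph T) :
    hypergraph T' := Hypergraph (hmapP f G).

Lemma hisoP (T T' : finType) (G : hypergraph T) (H : hypergraph T') :
  hiso G H <-> exists2 f, {in hverts G &, injective f} & H = hmap f G.
Proof.
split=> [[f [fI fV fE]] | [f fI ->]]; exists f => //.
by apply: hypergraph_eq; rewrite -?fV -?fE.
Qed.

Lemma hiso_hmap (T T' : finType) (f : T -> T') (G : hypergraph T) :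
  {in hverts G &, injective f} -> hiso G (hmap f G).
Proof. by move=> fI; apply/hisoP; exists f. Qed.

Lemma eq_in_hmap (T T' : finType) (f g : T -> T') (G : hypergraph T) :
  {in hverts G, f =1 g} -> hmap f G = hmap g G.
Proof.
move=> fg; apply: hypergraph_eq; first exact: eq_in_imset.
apply: eq_in_imset => e /hedge_sub/subsetP eG.
by apply: eq_in_imset => x /eG/fg.
Qed.

Lemma card_hiso (T T' : finType) (G : hypergraph T) (H : hypergraph T') :
  hiso G H -> #|hverts G| = #|hverts H|.
Proof. by case=> f [fI <- _]; rewrite card_in_imset. Qed.

(** * Sums of hypergraphs *)

(** Since every hyperedge is a nonempty set of vertices, removing the singletons
    amounts to a condition on cardinals. *)
Lemma hedges_hsum (T : finType) K (F : 'I_K.+1 -> hypergraph T) e :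
  (e \in hedges (hsum F)) =
  (1 < #|e|) && ((e == hverts (hsum F)) || [exists k, e \in hedges (F k)]).
Proof.
have exE : (e \in \bigcup_k hedges (F k)) = [exists k, e \in hedges (F k)].
  by apply/bigcupP/existsP => [[k _]|[k]]; exists k.
rewrite {1}/hedges /= in_setD in_setU in_set1 exE orbC.
have [eE | //] := boolP ((e == _) || _); last by rewrite !andbF.
have [e0 eV] : e != set0 /\ e \subset hverts (hsum F).
  case/orP: eE => [/eqP-> | /existsP[k ek]]; first by rewrite hverts_neq0.
  rewrite (hedge_neq0 ek); split=> //.
  exact: (subset_trans (hedge_sub ek) (bigcup_sup k _)).
rewrite !andbT ltn_neqAle card_gt0 e0 andbT eq_sym; congr (~~ _).
apply/imsetP/cards1P => [[x _ ->]|[x ex]]; exists x => //.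
by apply: (subsetP eV); rewrite ex set11.
Qed.

Lemma hverts_hsum_sup (T : finType) K (F : 'I_K.+1 -> hypergraph T) k :
  hverts (F k) \subset hverts (hsum F).
Proof. exact: (bigcup_sup k (F := fun j => hverts (F j))). Qed.

(** Injectivity matters for the singletons: a hyperedge must not become one. *)
Lemma hmap_hsum (T T' : finType) (f : T -> T') K (F : 'I_K.+1 -> hypergraph T) :
  {in hverts (hsum F) &, injective f} ->
  hmap f (hsum F) = hsum (fun k => hmap f (F k)).
Proof.
move=> fI; have fV : f @: hverts (hsum F) = hverts (hsum (fun k => hmap f (F k))).
  apply/setP => y; apply/imsetP/bigcupP.
    by case=> x /bigcupP[k _ xk] ->; exists k; rewrite ?imset_f.
  case=> k _ /imsetP[x xk ->]; exists x => //.
  by apply: (subsetP (hverts_hsum_sup F k)).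
apply: hypergraph_eq => //; apply/setP => e'; rewrite hedges_hsum.
have cardE (e : {set T}) : e \subset hverts (hsum F) -> #|f @: e| = #|e|.
  by move=> /subsetP eV; apply: card_in_imset => x y /eV + /eV; apply: fI.
apply/imsetP/andP => [[e eF ->] | [e'1 /orP[/eqP e'V | /existsP[k]]]].
- rewrite cardE ?hedge_sub //; move: eF; rewrite hedges_hsum.
  case/andP=> -> /orP[/eqP-> | /existsP[k ek]]; rewrite ?fV ?eqxx //.
  by split=> //; apply/orP; right; apply/existsP; exists k; apply: imset_f.
- exists (hverts (hsum F)); last by rewrite fV.
  by rewrite hedges_hsum eqxx /= andbT -cardE // fV -e'V.
- case/imsetP=> e ek e'E; exists e => //.
  have eV := subset_trans (hedge_sub ek) (hverts_hsum_sup F k).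
  rewrite hedges_hsum -cardE // -e'E e'1 /=; apply/orP; right.
  by apply/existsP; exists k.
Qed.

Lemma hsum_perm (T : finType) K (F : 'I_K.+1 -> hypergraph T) (p : 'S_K.+1) :
  hsum (fun k => F (p k)) = hsum F.
Proof.
have eqV : hverts (hsum (fun k => F (p k))) = hverts (hsum F).
  by rewrite [RHS](reindex_perm p).
apply: hypergraph_eq => //; apply/setP=> e; rewrite !hedges_hsum eqV.
congr (_ && (_ || _)); apply/existsP/existsP => -[k ek].
  by exists (p k).
by exists (p^-1%g k); rewrite permKV.
Qed.

Definition disjoint_family (T : finType) (I : finType) (F : I -> hypergraph T) :=
  forall i j, i != j -> [disjoint hverts (F i) & hverts (F j)].

Lemma disjoint_family_eq (T I : finType) (F : I -> hypergraph T) i j x :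
  disjoint_family F -> x \in hverts (F i) -> x \in hverts (F j) -> i = j.
Proof.
move=> dF xi xj; apply/eqP/negPn/negP => /dF/disjoint_setI0/setP/(_ x).
by rewrite !inE xi xj.
Qed.

Lemma disjoint_family_inj (T I : finType) (F : I -> hypergraph T) :
  disjoint_family F -> injective F.
Proof.
move=> dF i j eqF; have /set0Pn[x xi] := hverts_neq0 (F i).
by apply: (disjoint_family_eq dF xi); rewrite -eqF.
Qed.

Lemma disjoint_family_hmap (T T' : finType) (f : T -> T') K
    (F : 'I_K.+1 -> hypergraph T) :
  {in hverts (hsum F) &, injective f} -> disjoint_family F ->
  disjoint_family (fun k => hmap f (F k)).
Proof.
move=> fI dF i j ij; apply/pred0P => y /=; apply/negP => /andP[].
case/imsetP=> x xi -> /imsetP[z zj xz]; case/eqP: ij.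
apply: (disjoint_family_eq dF xi).
by rewrite (fI x z) //; apply: (subsetP (hverts_hsum_sup F _)); eassumption.
Qed.

Lemma card_hverts_hsum (T : finType) K (F : 'I_K.+1 -> hypergraph T) :
  disjoint_family F ->
  #|hverts (hsum F)| = sumn [seq #|hverts (F k)| | k <- enum 'I_K.+1].
Proof.
move=> dF; rewrite sumnE big_map big_enum /= -sum1_card.
rewrite [LHS]partition_disjoint_bigcup //.
by apply: eq_bigr => k _; rewrite sum1_card.
Qed.

(** Isomorphisms between the summands glue along the disjoint vertex sets. *)
Lemma hiso_hsum (T T' : finType) K (F : 'I_K.+1 -> hypergraph T)
    (F' : 'I_K.+1 -> hypergraph T') :
  disjoint_family F -> disjoint_family F' -> (forall k, hiso (F k) (F' k)) ->
  hiso (hsum F) (hsum F').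
Proof.
move=> dF dF' FF'.
have /choice[f fP] k : exists f, {in hverts (F k) &, injective f} /\ F' k = hmap f (F k).
  by have /hisoP[f fI fE] := FF' k; exists f.
(* [c x] is the index of the summand of [x]; the default is never read on the
   vertices of the sum. *)
pose c x := odflt ord0 [pick k | x \in hverts (F k)].
have cE k x : x \in hverts (F k) -> c x = k.
  rewrite /c => xk; case: pickP => [j xj | /(_ k)] /=; last by rewrite xk.
  exact: (disjoint_family_eq dF xj xk).
pose g x := f (c x) x.
have gE k : hmap g (F k) = F' k.
  by case: (fP k) => _ ->; apply: eq_in_hmap => x /cE; rewrite /g => ->.
have gI : {in hverts (hsum F) &, injective g}.
  move=> x y /bigcupP[i _ xi] /bigcupP[j _ yj] gxy.
  have gF z k : z \in hverts (F k) -> g z \in hverts (F' k).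
    by rewrite -gE => zk; apply: imset_f.
  have ij : i = j.
    by apply: (disjoint_family_eq dF' (gF _ _ xi)); rewrite gxy gF.
  move: gxy; rewrite /g (cE _ _ xi) (cE _ _ yj) -ij.
  by apply: (fP i).1; rewrite ?ij // -ij.
apply/hisoP; exists g => //; rewrite hmap_hsum //; congr hsum.
by apply: funext => k; rewrite gE.
Qed.

(** * Finite fractal hyper-trees *)

Scheme fht_mut := Induction for fht Sort Prop
  with imbricated_mut := Induction for imbricated Sort Prop.

Lemma flat_hmap (T T' : finType) (f : T -> T') (H : hypergraph T) :
  {in hverts H &, injective f} -> flat H -> flat (hmap f H).
Proof.
move=> fI [cH sH]; split=> [_ _ /imsetP[x xV ->] /imsetP[y yV ->] | ].
  have [e [p [epE xe ye ep]]] := cH x y xV yV.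
  exists (f @: e), [seq f @: (a : {set T}) | a <- p]; split.
  - by rewrite -map_cons => _ /mapP[a /epE aE ->]; apply: imset_f.
  - exact: imset_f.
  - by rewrite last_map imset_f.
  - rewrite path_map; apply: sub_path ep => a b /= /set0Pn[z /setIP[za zb]].
    by apply/set0Pn; exists (f z); rewrite inE !imset_f.
move=> _ _ /imsetP[e eH ->] /imsetP[e' e'H ->] /subsetP fee'.
suff -> : e = e' by []; apply: sH => //; apply/subsetP => x xe.
have /imsetP[y ye' /fI xy] := fee' _ (imset_f f xe).
rewrite xy //; first exact: (subsetP (hedge_sub eH)).
exact: (subsetP (hedge_sub e'H)).
Qed.

(** Both predicates quantify over a family of summands in the ambient type, which
    can be transported along the map; hence a mutual induction. *)
Lemma fht_imbricated_hmap (T : finType) (H : hypergraph T) :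
  (fht H -> forall (T' : finType) (f : T -> T'),
    {in hverts H &, injective f} -> fht (hmap f H)) /\
  (imbricated H -> forall (T' : finType) (f : T -> T'),
    {in hverts H &, injective f} -> imbricated (hmap f H)).
Proof.
pose P (G : hypergraph T) (_ : fht G) := forall (T' : finType) (f : T -> T'),
  {in hverts G &, injective f} -> fht (hmap f G).
pose P0 (G : hypergraph T) (_ : imbricated G) :=
  forall (T' : finType) (f : T -> T'),
  {in hverts G &, injective f} -> imbricated (hmap f G).
have PF G (flatG : flat G) : P G (FlatFHT flatG).
  by move=> T' f fI; apply: FlatFHT; apply: flat_hmap.
have PI G (iG : imbricated G) : P0 G iG -> P G (ImbricatedFHT iG).
  by move=> iH T' f fI; apply: ImbricatedFHT; apply: iH.
have P0I v K (F : 'I_K.+1 -> hypergraph T) (v2 : 2 < v)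
    (fF : forall k, fht (F k)) (IH : forall k, P (F k) (fF k)) dF pF :
  P0 (hsum F) (Imbricated v2 fF dF pF).
  move=> T' f fI; rewrite hmap_hsum //.
  have fIk k : {in hverts (F k) &, injective f}.
    by move=> x y xk yk; apply: fI; apply: (subsetP (hverts_hsum_sup F k)).
  apply: (@Imbricated _ v) => // [k | | ]; first exact: IH.
    exact: disjoint_family_hmap.
  by under eq_map => k do rewrite card_in_imset //.
split=> h.
- exact: (@fht_mut T P P0 PF PI P0I).
- exact: (@imbricated_mut T P P0 PF PI P0I).
Qed.

Lemma flat_hiso (T T' : finType) (G : hypergraph T) (H : hypergraph T') :
  hiso G H -> flat G -> flat H.
Proof. by case/hisoP=> f fI ->; apply: flat_hmap. Qed.

Lemma imbricated_hiso (T T' : finType) (G : hypergraph T) (H : hypergraph T') :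
  hiso G H -> imbricated G -> imbricated H.
Proof. by case/hisoP=> f fI -> iG; apply: (fht_imbricated_hmap G).2. Qed.

Lemma fht_hiso (T T' : finType) (G : hypergraph T) (H : hypergraph T') :
  hiso G H -> fht G -> fht H.
Proof. by case/hisoP=> f fI -> iG; apply: (fht_imbricated_hmap G).1. Qed.

(** The data behind an imbricated structure, the partitioned number being read
    off the sum instead of given beforehand. *)
Definition decomposition (T : finType) K (F : 'I_K.+1 -> hypergraph T) :=
  [/\ forall k, fht (F k), disjoint_family F
    & proper_partition #|hverts (hsum F)|
        [seq #|hverts (F k)| | k <- enum 'I_K.+1]].

Lemma proper_partition_gt2 v s : proper_partition v s -> 2 < v.
Proof.
case/and4P; case: s => [|a [|b s]] //= _ /eqP <- a1.
  by rewrite addn0 andbT ltnn andbF.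
case/and3P=> _ /andP[b0 _] _.
by rewrite -[3]/(2 + 1) leq_add // ltn_addr.
Qed.

Lemma imbricatedP (T : finType) (H : hypergraph T) :
  imbricated H <-> exists K (F : 'I_K.+1 -> hypergraph T),
    decomposition F /\ H = hsum F.
Proof.
split=> [[v K F v2 fF dF pF] | [K [F [[fF dF pF] ->]]]]; last first.
  exact: (Imbricated (proper_partition_gt2 pF)).
exists K, F; split=> //; split=> //; rewrite card_hverts_hsum //.
by have /and4P[_ /eqP-> _ _] := pF.
Qed.

Lemma decomposition_gt2 (T : finType) K (F : 'I_K.+1 -> hypergraph T) :
  decomposition F -> 2 < #|hverts (hsum F)|.
Proof. by case=> _ _ /proper_partition_gt2. Qed.

Lemma decomposition_lt (T : finType) K (F : 'I_K.+1 -> hypergraph T) k :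
  decomposition F -> #|hverts (F k)| < #|hverts (hsum F)|.
Proof.
case=> _ _ /and4P[_ _ _ /allP/(_ #|hverts (F k)|)].
by rewrite map_f ?mem_enum // => /(_ isT)/andP[].
Qed.

Lemma decomposition_gt1 (T : finType) K (F : 'I_K.+1 -> hypergraph T) :
  decomposition F -> 1 < #|hverts (F ord0)|.
Proof. by case=> _ _ /and4P[_ _ + _]; rewrite enum_ordSl. Qed.

Lemma decomposition_hmap (T T' : finType) (f : T -> T') K
    (F : 'I_K.+1 -> hypergraph T) :
  {in hverts (hsum F) &, injective f} -> decomposition F ->
  decomposition (fun k => hmap f (F k)).
Proof.
move=> fI [fF dF pF]; have fIk k : {in hverts (F k) &, injective f}.
  by move=> x y xk yk; apply: fI; apply: (subsetP (hverts_hsum_sup F k)).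
split=> [k | | ]; first exact: fht_hiso (hiso_hmap (fIk k)) (fF k).
  exact: disjoint_family_hmap.
rewrite -hmap_hsum // card_in_imset //.
by under eq_map => k do rewrite card_in_imset //.
Qed.

Lemma hverts_in_hedges (T : finType) (H : hypergraph T) :
  imbricated H -> hverts H \in hedges H.
Proof.
case/imbricatedP=> K [F [/decomposition_gt2 F2 ->]].
by rewrite hedges_hsum eqxx /= andbT; apply: leq_trans F2.
Qed.

(** The hyperedge of all vertices connects an imbricated structure at once. *)
Lemma fht_connected (T : finType) (H : hypergraph T) : fht H -> connected H.
Proof.
case=> [G [] // | G iG] x y xV yV; exists (hverts G), [::]; split=> //.
by move=> e; rewrite inE => /eqP->; apply: hverts_in_hedges.
Qed.

(** A hyperedge reduced to [x] would be comparable with the hyperedge through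
    which [x] is connected to another vertex. *)
Lemma hedge_gt1 (T : finType) (H : hypergraph T) e :
  fht H -> 1 < #|hverts H| -> e \in hedges H -> 1 < #|e|.
Proof.
case=> [G [cG sG] V1 eG | G /imbricatedP[K [F [_ ->]]] _]; last first.
  by rewrite hedges_hsum => /andP[].
rewrite ltn_neqAle card_gt0 (hedge_neq0 eG) andbT eq_sym.
apply/cards1P => -[x ex].
have xV : x \in hverts G by apply: (subsetP (hedge_sub eG)); rewrite ex set11.
(* The singleton [e] is the only hyperedge through [x], so no path leaves [x]. *)
have only_e a : a \in hedges G -> x \in a -> a = [set x].
  by move=> aG xa; rewrite -ex; symmetry; apply: sG; rewrite // ex sub1set.
have /card_gt1P[y [z [yV zV yz]]] := V1.
have all_x t : t \in hverts G -> t = x.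
  move=> tV; have [a [p [apG xa]]] := cG x t xV tV.
  elim: p a apG xa => [|b p IH] a apG xa /=.
    by rewrite (only_e a) ?apG ?mem_head // => /set1P.
  move=> tb /andP[/set0Pn[u /setIP[ua ub]] bp].
  apply: (IH b) => // [c cbp | ]; first by apply: apG; rewrite inE cbp orbT.
  by move: ua; rewrite (only_e a) ?apG ?mem_head // => /set1P <-.
by case/eqP: yz; rewrite (all_x y yV) (all_x z zV).
Qed.

(** Connectedness forces a hyperedge to exist, and there is one candidate. *)
Lemma hedges_card1 (T : finType) (H : hypergraph T) :
  fht H -> #|hverts H| = 1 -> hedges H = [set hverts H].
Proof.
move=> fH V1; have [x VE] : exists x, hverts H = [set x] by apply/cards1P; rewrite V1.
have edgeE e : e \in hedges H -> e = [set x].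
  move=> eH; have := hedge_sub eH; rewrite VE subset1 (negPf (hedge_neq0 eH)).
  by rewrite orbF => /eqP.
have [e [p [epH _ _ _]]] : exists (e : {set T}) (p : seq {set T}),
    [/\ {subset e :: p <= hedges H}, x \in e, x \in last e p
      & path (fun a b : {set T} => a :&: b != set0) e p].
  by apply: fht_connected; rewrite // VE set11.
have eH : e \in hedges H by apply: epH; rewrite mem_head.
apply/setP => a; rewrite inE VE; apply/idP/eqP => [/edgeE // | ->].
by rewrite -(edgeE _ eH).
Qed.

(** The first summand of an imbricated structure provides a hyperedge strictly
    contained in the hyperedge formed by all the vertices. *)
Lemma imbricated_not_flat (T : finType) (H : hypergraph T) :
  imbricated H -> ~ flat H.
Proof.
move=> iH [_ sH]; have VH := hverts_in_hedges iH.
have /imbricatedP[K [F [dF HE]]] := iH; rewrite HE in sH VH.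
have [fF _ _] := dF; have V1 := decomposition_gt1 dF.
have /set0Pn[x xV] := hverts_neq0 (F ord0).
have [e [p [epF _ _ _]]] := fht_connected (fF ord0) xV xV.
have eF : e \in hedges (F ord0) by apply: epF; rewrite mem_head.
have eH : e \in hedges (hsum F).
  rewrite hedges_hsum (hedge_gt1 (fF _) V1 eF); apply/orP; right.
  by apply/existsP; exists ord0.
have eV := sH _ _ eH VH (hedge_sub eH).
have := decomposition_lt ord0 dF; rewrite -eV ltnNge subset_leq_card //.
exact: hedge_sub.
Qed.

(** * Uniqueness of the summands *)

(** A path of intersecting hyperedges cannot leave the block it starts in. *)
Lemma connected_sub (T I : finType) (G : hypergraph T) (W : I -> {set T}) :
  connected G -> (forall i j, i != j -> [disjoint W i & W j]) ->
  (forall e, e \in hedges G -> exists i, e \subset W i) ->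
  exists i, hverts G \subset W i.
Proof.
move=> cG dW eW.
have dWx i j x : x \in W i -> x \in W j -> i = j.
  move=> xi xj; apply/eqP/negPn/negP => /dW/disjoint_setI0/setP/(_ x).
  by rewrite !inE xi xj.
have /set0Pn[x xV] := hverts_neq0 G.
have [i xi] : exists i, x \in W i.
  have [e [p [epG xe _ _]]] := cG x x xV xV.
  have [|i ei] := eW e; first by apply: epG; rewrite mem_head.
  by exists i; apply: (subsetP ei).
exists i; apply/subsetP => y yV.
have [e [p [epG xe ye ep]]] := cG x y xV yV.
elim: p e x xi epG xe ye ep {xV} => [|b p IH] e x xi epG xe /=.
  move=> ye _; have [|j ej] := eW e; first by apply: epG; rewrite mem_head.
  by rewrite (dWx i j x) ?(subsetP ej).
move=> yb /andP[/set0Pn[u /setIP[ue ub]] bp].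
apply: (IH b u) => // [|c cbp]; last by apply: epG; rewrite inE cbp orbT.
have [|j ej] := eW e; first by apply: epG; rewrite mem_head.
by rewrite (dWx i j x) ?(subsetP ej).
Qed.

Lemma hverts_hsum_notsub (T : finType) K (F : 'I_K.+1 -> hypergraph T) k :
  decomposition F -> ~~ (hverts (hsum F) \subset hverts (F k)).
Proof.
move=> /(decomposition_lt k); rewrite ltnNge; apply: contra.
exact: subset_leq_card.
Qed.

(** The two conventions of the sum leave no trace inside a summand: no singleton
    was removed from it, and the added hyperedge is too large for it. *)
Lemma hedges_summand (T : finType) K (F : 'I_K.+1 -> hypergraph T) k :
  decomposition F -> 1 < #|hverts (F k)| ->
  hedges (F k) = [set e in hedges (hsum F) | e \subset hverts (F k)].
Proof.
move=> DF V1; have [fF dF _] := DF; apply/setP => e.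
rewrite inE hedges_hsum; apply/idP/andP => [ek | [/andP[e1 +] ek]].
  rewrite (hedge_gt1 (fF k) V1 ek) (hedge_sub ek); split=> //.
  by apply/orP; right; apply/existsP; exists k.
case/orP=> [/eqP eV | /existsP[j ej]].
  by have := hverts_hsum_notsub k DF; rewrite -eV ek.
have /set0Pn[x xe] := hedge_neq0 ej.
rewrite (_ : k = j) //; apply: (disjoint_family_eq dF (x := x)).
  exact: (subsetP ek).
exact: (subsetP (hedge_sub ej)).
Qed.

(** A large summand stays connected within any other decomposition, as its
    hyperedges are distinct from the hyperedge of all vertices. *)
Lemma summand_sub (T : finType) K K' (F : 'I_K.+1 -> hypergraph T)
    (F' : 'I_K'.+1 -> hypergraph T) k :
  decomposition F -> decomposition F' -> hsum F = hsum F' ->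
  1 < #|hverts (F k)| -> exists j, hverts (F k) \subset hverts (F' j).
Proof.
move=> DF DF' FF' V1; have [[fF _ _] [_ dF' _]] := (DF, DF').
apply: connected_sub => [|//|e]; first exact: fht_connected.
rewrite hedges_summand // inE FF' hedges_hsum => /andP[/andP[_ +] ek].
case/orP=> [/eqP eV | /existsP[j ej]]; last by exists j; apply: hedge_sub.
by have := hverts_hsum_notsub k DF; rewrite FF' -eV ek.
Qed.

(** The vertex sets of the summands are the connected components left by the
    removal of the hyperedge of all vertices; the hyperedges inside them are
    then determined, up to the convention on one vertex. *)
Lemma summand_unique (T : finType) K K' (F : 'I_K.+1 -> hypergraph T)
    (F' : 'I_K'.+1 -> hypergraph T) k :
  decomposition F -> decomposition F' -> hsum F = hsum F' ->
  exists j, F k = F' j.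
Proof.
(* Inclusions in both directions, hence equal components, for large summands. *)
have large K1 K2 (F1 : 'I_K1.+1 -> hypergraph T) (F2 : 'I_K2.+1 -> _) i :
    decomposition F1 -> decomposition F2 -> hsum F1 = hsum F2 ->
    1 < #|hverts (F1 i)| -> exists j, F1 i = F2 j.
  move=> D1 D2 F12 V1.
  have [j ij] := summand_sub D1 D2 F12 V1.
  have V2 : 1 < #|hverts (F2 j)| by apply: leq_trans (subset_leq_card ij).
  have [i' ji] := summand_sub D2 D1 (esym F12) V2.
  have ii' : i = i'.
    have [_ d1 _] := D1; have /set0Pn[x xi] := hverts_neq0 (F1 i).
    apply: (disjoint_family_eq d1 xi); apply: (subsetP ji).
    exact: (subsetP ij).
  have eqV : hverts (F1 i) = hverts (F2 j).
    by apply/eqP; rewrite eqEsubset ij ii' ji.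
  exists j; apply: hypergraph_eq => //.
  by rewrite !hedges_summand // eqV F12.
move=> DF DF' FF'; have [V1 | Vle1] := ltnP 1 #|hverts (F k)|.
  exact: large V1.
have [fF dF _] := DF; have [fF' _ _] := DF'.
have Vk : #|hverts (F k)| = 1.
  by apply/eqP; rewrite eqn_leq Vle1 card_gt0 hverts_neq0.
have [x VE] : exists x, hverts (F k) = [set x] by apply/cards1P; rewrite Vk.
have xk : x \in hverts (F k) by rewrite VE set11.
have /bigcupP[j _ xj] : x \in hverts (hsum F').
  by rewrite -FF'; apply: (subsetP (hverts_hsum_sup F k)).
(* A large summand of [F'] containing [x] is a summand of [F], hence [F k]. *)
have [V1 | Vjle1] := ltnP 1 #|hverts (F' j)|.
  have [i ji] := large _ _ _ _ _ DF' DF (esym FF') V1.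
  exists j; rewrite ji in xj *.
  by rewrite (disjoint_family_eq dF xk xj).
have Vj : #|hverts (F' j)| = 1.
  by apply/eqP; rewrite eqn_leq Vjle1 card_gt0 hverts_neq0.
have eqV : hverts (F k) = hverts (F' j).
  by apply/eqP; rewrite eqEcard Vk Vj VE sub1set xj.
by exists j; apply: hypergraph_eq; rewrite ?hedges_card1 ?eqV.
Qed.

Lemma decomposition_unique (T : finType) K K' (F : 'I_K.+1 -> hypergraph T)
    (F' : 'I_K'.+1 -> hypergraph T) :
  decomposition F -> decomposition F' -> hsum F = hsum F' ->
  perm_eq (codom F) (codom F').
Proof.
move=> DF DF' FF'; have [[_ dF _] [_ dF' _]] := (DF, DF').
apply: uniq_perm.
- exact/injectiveP/disjoint_family_inj.
- exact/injectiveP/disjoint_family_inj.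
- move=> G; apply/codomP/codomP => -[k ->].
    by have [j ->] := summand_unique k DF DF' FF'; exists j.
  by have [j ->] := summand_unique k DF' DF (esym FF'); exists j.
Qed.

(** * Counting multisets *)

Section Multisets.
Variables (X : finType) (B : nat).

(** Multiplicities are bounded by [B] so that multisets form a finite type. *)
Definition multiplicity (s : seq X) : {ffun X -> 'I_B.+1} :=
  [ffun x => inord (count_mem x s)].

Lemma multiplicityE s x : size s <= B -> multiplicity s x = count_mem x s :> nat.
Proof.
by move=> sB; rewrite ffunE inordK // ltnS (leq_trans (count_size _ _)).
Qed.

Lemma perm_multiplicity s t : perm_eq s t -> multiplicity s = multiplicity t.
Proof. by move/seq.permP => st; apply/ffunP => x; rewrite !ffunE st. Qed.

Lemma multiplicity_perm s t : size s <= B -> size t <= B ->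
  multiplicity s = multiplicity t -> perm_eq s t.
Proof.
move=> sB tB st; apply/allP => x _ /=; apply/eqP.
by rewrite -!multiplicityE ?st.
Qed.

Lemma multiplicity_surj (M : X -> nat) : exists s, forall x, count_mem x s = M x.
Proof.
exists (flatten [seq nseq (M x) x | x <- enum X]) => x.
rewrite count_flatten sumnE -map_comp big_map big_enum /= (bigD1 x) //=.
rewrite count_nseq /= eqxx mul1n big1 ?addn0 // => y yx.
by rewrite count_nseq /= (negPf yx).
Qed.

Lemma sum_count_mem (P : pred X) s : \sum_(x | P x) count_mem x s = count P s.
Proof.
elim: s => [|y s IH] /=; first exact: big1.
rewrite big_split /= IH; congr (_ + _).
rewrite -big_mkcondr /=; case Py: (P y).
  by rewrite (big_pred1 y) // => x; rewrite eq_sym andb_idl // => /eqP->.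
by apply: big_pred0 => x; apply/andP => -[Px /eqP yx]; rewrite yx Px in Py.
Qed.

Definition multisets (A : {set X}) m : {set {ffun X -> 'I_B.+1}} :=
  [set M : {ffun X -> 'I_B.+1} |
    [forall x, (x \notin A) ==> (M x == ord0)] & \sum_x (M x : nat) == m].

Lemma multisetsP (A : {set X}) m (M : {ffun X -> 'I_B.+1}) :
  reflect ((forall x, x \notin A -> M x = ord0) /\ \sum_x (M x : nat) = m)
          (M \in multisets A m).
Proof.
rewrite inE; apply: (iffP andP) => [[/forallP A0 /eqP] | [A0 ->]].
  by split=> // x xA; apply/eqP/(implyP (A0 x)).
by split=> //; apply/forallP => x; apply/implyP => /A0->.
Qed.

Lemma multiset0P (M : {ffun X -> 'I_B.+1}) :
  reflect (M = [ffun=> ord0]) (\sum_x (M x : nat) == 0).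
Proof.
rewrite sum_nat_eq0; apply: (iffP forall_inP) => [M0 | -> x _].
  by apply/ffunP => x; apply/val_inj/eqP; rewrite ffunE M0.
by rewrite ffunE.
Qed.

(** Pascal's rule on a chosen element [a] of [A]: a multiset of size [m.+1]
    either avoids [a], or arises from one of size [m] by adding a copy of [a]. *)
Lemma card_multisets (A : {set X}) m :
  m <= B -> #|multisets A m| = 'C(#|A| + m - 1, m).
Proof.
have [n] := ubnP (#|A| + m); elim: n A m => // n IH A [|m] Am mB.
  rewrite bin0 (_ : multisets A 0 = [set [ffun=> ord0]]) ?cards1 //.
  apply/setP => M; rewrite in_set1; apply/multisetsP/eqP.
    by case=> _ /eqP/multiset0P.
  by move=> M0; split=> [x _|]; [rewrite M0 ffunE | apply/eqP/multiset0P].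
have [-> | /set0Pn[a aA]] := eqVneq A set0.
  rewrite cards0 add0n subn1 bin_small //; apply/eqP; rewrite cards_eq0.
  apply/eqP/setP => M; rewrite in_set0; apply/multisetsP => -[M0].
  by rewrite big1 // => x _; rewrite M0 ?inE.
(* [inc] adds a copy of [a]; the bound [m.+1 <= B] leaves room for it. *)
pose inc (M : {ffun X -> 'I_B.+1}) : {ffun X -> 'I_B.+1} :=
  [ffun x => if x == a then inord (M x).+1 else M x].
have sumE (M : {ffun X -> 'I_B.+1}) :
    \sum_x (M x : nat) = M a + \sum_(x | x != a) (M x : nat).
  exact: bigD1.
have incE (M : {ffun X -> 'I_B.+1}) : M \in multisets A m -> inc M a = (M a).+1 :> nat.
  case/multisetsP => _ Mm; rewrite ffunE eqxx inordK // ltnS.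
  by apply: leq_ltn_trans mB; rewrite -Mm sumE leq_addr.
have inc_inj : {in multisets A m &, injective inc}.
  move=> M N MA NA eqi; apply/ffunP => x.
  have [-> | xa] := eqVneq x a.
    by apply: val_inj; apply: succn_inj; rewrite /= -!incE // eqi.
  by have /ffunP/(_ x) := eqi; rewrite !ffunE (negPf xa).
have splitE : multisets A m.+1 = multisets (A :\ a) m.+1 :|: inc @: multisets A m.
  apply/setP => M; rewrite in_setU; apply/idP/orP => [MA | [MA | /imsetP[N NA ->]]].
  - have /multisetsP[M0 Mm] := MA.
    have [Ma | Ma] := eqVneq (M a) ord0; [left | right].
      apply/multisetsP; split=> // x; rewrite !inE negb_and negbK.
      by case/orP=> [/eqP-> | /M0].
    have Ma0 : 0 < M a by rewrite lt0n; apply: contra Ma => /eqP Ma; apply/eqP/val_inj.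
    have predK : (M a).-1 < B.+1 by apply: leq_ltn_trans (leq_pred _) (ltn_ord _).
    pose N : {ffun X -> 'I_B.+1} :=
      [ffun x => if x == a then inord (M x).-1 else M x].
    apply/imsetP; exists N; last first.
      apply/ffunP => x; rewrite !ffunE; case: eqP => // ->.
      by apply: val_inj; rewrite /= !inordK // prednK.
    apply/multisetsP; split=> [x xA | ].
      rewrite ffunE; case: eqP => [xa | _]; last exact: M0.
      by rewrite xa aA in xA.
    apply: succn_inj; rewrite -Mm !sumE -addSn ffunE eqxx inordK // prednK //.
    by congr (_ + _); apply: eq_bigr => x xa; rewrite ffunE (negPf xa).
  - have /multisetsP[M0 Mm] := MA; apply/multisetsP; split=> // x xA.
    by apply: M0; rewrite !inE (negPf xA) andbF.
  - have /multisetsP[N0 Nm] := NA; apply/multisetsP; split=> [x xA | ].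
      rewrite ffunE; case: eqP => [xa | _]; last exact: N0.
      by rewrite xa aA in xA.
    rewrite sumE incE // addSn; congr _.+1; rewrite -Nm sumE; congr (_ + _).
    by apply: eq_bigr => x xa; rewrite ffunE (negPf xa).
have disj : multisets (A :\ a) m.+1 :&: inc @: multisets A m = set0.
  apply/setP => M; rewrite in_set0 in_setI; apply/andP => -[/multisetsP[M0 _]].
  case/imsetP=> N NA MN; have := incE _ NA.
  by rewrite -MN M0 // !inE eqxx.
rewrite splitE cardsU disj cards0 subn0 card_in_imset //.
have cA : #|A| = #|A :\ a|.+1 by rewrite (cardsD1 a) aA.
rewrite !IH ?(ltnW mB) //; first last.
- by move: Am; rewrite cA addSn ltnS.
- by move: Am; rewrite addnS ltnS.
by rewrite cA addSn !addnS !subn1 /= binS.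
Qed.

(** Choosing a multiset with prescribed total multiplicity in each colour class
    amounts to choosing a multiset in each class independently. *)
Lemma card_coloured_multisets (I : finType) (A : {set X}) (c : X -> I)
    (m : I -> nat) :
  (forall i, m i <= B) ->
  #|[set M : {ffun X -> 'I_B.+1} |
      [forall x, (x \notin A) ==> (M x == ord0)]
    & [forall i, \sum_(x in A | c x == i) (M x : nat) == m i]]| =
  \prod_i 'C(#|[set x in A | c x == i]| + m i - 1, m i).
Proof.
move=> mB; pose C i := [set x in A | c x == i].
pose glue (G : {ffun I -> {ffun X -> 'I_B.+1}}) : {ffun X -> 'I_B.+1} :=
  [ffun x => G (c x) x].
pose N := family (fun i => mem (multisets (C i) (m i))).
have glueE (G : {ffun I -> {ffun X -> 'I_B.+1}}) i x : G \in N ->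
    G i x = if c x == i then glue G x else ord0.
  move=> /familyP/(_ i)/multisetsP[G0 _]; case: eqP => [<- | /eqP cx].
    by rewrite ffunE.
  by apply: G0; rewrite inE (negPf cx) andbF.
have glue_inj : {in N &, injective glue}.
  move=> G G' GN GN' eqG; apply/ffunP => i; apply/ffunP => x.
  by rewrite !glueE // eqG.
have sumC (M : {ffun X -> 'I_B.+1}) i : (forall x, x \notin A -> M x = ord0) ->
    \sum_x (if c x == i then M x : nat else 0) =
    \sum_(x in A | c x == i) (M x : nat).
  move=> M0; rewrite [RHS]big_mkcond /=; apply: eq_bigr => x _.
  by case: (boolP (x \in A)) => [_ | /M0->] //=; case: ifP.
transitivity #|[set glue G | G in N]|.
  apply: eq_card => M; rewrite inE; apply/andP/imsetP.
    case=> /forallP M0 /forallP Mm.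
    have {}M0 x : x \notin A -> M x = ord0 by move/(implyP (M0 x))/eqP.
    exists [ffun i => [ffun x => if c x == i then M x else ord0]]; last first.
      by apply/ffunP => x; rewrite !ffunE eqxx.
    apply/familyP => i; rewrite ffunE; apply/multisetsP; split=> [x|].
      by rewrite inE negb_and ffunE => /orP[/M0-> | /negPf->] //; case: ifP.
    rewrite -(eqP (Mm i)) -sumC //.
    by apply: eq_bigr => x _; rewrite ffunE; case: ifP.
  case=> G GN ->; have glue0 x : x \notin A -> glue G x = ord0.
    move=> xA; rewrite ffunE; have /familyP/(_ (c x))/multisetsP[G0 _] := GN.
    by apply: G0; rewrite inE (negPf xA).
  split; first by apply/forallP => x; apply/implyP => /glue0->.
  apply/forallP => i; apply/eqP; have /familyP/(_ i)/multisetsP[_ <-] := GN.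
  rewrite -sumC //; apply: eq_bigr => x _.
  by rewrite [in RHS]glueE //; case: ifP.
rewrite card_in_imset // card_family foldrE big_map big_enum /=.
by apply: eq_bigr => i _; apply: card_multisets.
Qed.

End Multisets.

(** Replaces an equivalence relation by a complete invariant, whose values can be
    described directly. *)
Lemma card_equivalence_partition (T I : finType) (R : rel T) (D : {set T})
    (inv : T -> I) :
  {in D &, forall x y, R x y = (inv x == inv y)} ->
  #|equivalence_partition R D| = #|inv @: D|.
Proof.
move=> Rinv; pose fiber i := [set y in D | i == inv y].
have -> : equivalence_partition R D = fiber @: (inv @: D).
  rewrite -imset_comp; apply: eq_in_imset => x xD /=.
  by apply/setP => y; rewrite !inE; apply: andb_id2l => yD; apply: Rinv.
apply: card_in_imset => _ _ /imsetP[x xD ->] /imsetP[y yD ->] eqF.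
by have /setP/(_ x) := eqF; rewrite !inE xD eqxx => /esym/eqP.
Qed.

(** * Representatives of isomorphism classes *)

Definition rep (T : finType) (G : hypergraph T) : hypergraph T :=
  choose (fun G' => `[< hiso G G' >]) G.

Lemma hiso_rep (T : finType) (G : hypergraph T) : hiso G (rep G).
Proof.
apply/asboolP; apply: (@chooseP _ (fun G' => `[< hiso G G' >])).
exact/asboolP/hiso_refl.
Qed.

(** The choice operator depends only on the extent of the predicate, which is
    the same for isomorphic hypergraphs. *)
Lemma rep_eq (T : finType) (G H : hypergraph T) : hiso G H <-> rep G = rep H.
Proof.
split=> [GH | eqr].
  rewrite /rep (_ : (fun G' => `[< hiso G G' >]) = (fun G' => `[< hiso H G' >])).
    by apply: choose_id; apply/asboolP; [apply: hiso_sym | apply: hiso_refl].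
  apply: funext => G'; apply: asbool_equiv_eq; split; apply: hiso_trans => //.
  exact: hiso_sym.
by apply: hiso_trans (hiso_rep G) _; rewrite eqr; apply/hiso_sym/hiso_rep.
Qed.

Lemma rep_id (T : finType) (G : hypergraph T) : rep (rep G) = rep G.
Proof. by apply/esym/rep_eq/hiso_rep. Qed.

(** Widening ['I_s] to ['I_v] matches the classes of hypergraphs on all of ['I_s]
    with the classes in ['I_v] of hypergraphs with [s] vertices. *)
Lemma num_classes_rep (P : forall T : finType, hypergraph T -> Prop) s v :
  (forall (T T' : finType) (G : hypergraph T) (H : hypergraph T'),
     hiso G H -> P T G -> P T' H) ->
  s <= v ->
  num_classes (P 'I_s) =
  #|[set G : hypergraph 'I_v | [&& rep G == G, #|hverts G| == s & `[< P _ G >]]]|.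
Proof.
move=> Piso sv; pose w := widen_ord sv.
have wI : injective w by move=> i j /(congr1 val) /= ij; apply: val_inj.
have wiso (G : hypergraph 'I_s) : hiso G (hmap w G).
  by apply: hiso_hmap => x y _ _; apply: wI.
have repiso (G : hypergraph 'I_s) : hiso G (rep (hmap w G)).
  exact: hiso_trans (wiso G) (hiso_rep _).
rewrite /num_classes (card_equivalence_partition (inv := fun G => rep (hmap w G))).
  apply: eq_card => G; rewrite inE; apply/imsetP/and3P.
    case=> H; rewrite inE => /andP[/eqP HV /asboolP PH] ->; split.
    - by rewrite rep_id.
    - by rewrite -(card_hiso (repiso H)) HV cardsT card_ord.
    - by apply/asboolP; apply: Piso PH.
  case=> /eqP rG /eqP /hiso_ord[H HV GH] /asboolP PG; exists H.
    by rewrite inE HV eqxx; apply/asboolP; apply: Piso PG.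
  by rewrite -rG; apply/rep_eq; apply: hiso_trans GH (wiso H).
move=> G H _ _; apply/asboolP/eqP => [GH | /rep_eq GH].
  apply/rep_eq; apply: hiso_trans (wiso H); apply: hiso_trans GH.
  exact/hiso_sym.
apply: hiso_trans (wiso G) _; apply: hiso_trans GH _; exact/hiso_sym.
Qed.

Definition fht_reps (T : finType) : {set hypergraph T} :=
  [set G | rep G == G & `[< fht G >]].

(** Flat and imbricated classes are disjoint, so that their numbers add up. *)
Lemma num_fht_rep s v : s <= v ->
  num_fht s = #|[set G in fht_reps 'I_v | #|hverts G| == s]|.
Proof.
move=> sv; rewrite /num_fht /num_flat /num_imbricated.
rewrite (@num_classes_rep (@flat) _ v) //; last exact: flat_hiso.
rewrite (@num_classes_rep (@imbricated) _ v) //; last exact: imbricated_hiso.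
rewrite -cardsUI [X in _ + X](_ : _ = 0) ?addn0; last first.
  apply/eqP; rewrite cards_eq0; apply/eqP/setP => G; rewrite !inE.
  apply/negP => /andP[/and3P[_ _ /asboolP fG] /and3P[_ _ /asboolP iG]].
  exact: imbricated_not_flat fG.
apply: eq_card => G; rewrite !inE -andb_orr -andb_orr -andbA.
rewrite [`[< fht G >] && _]andbC; congr [&& _, _ & _].
apply/orP/asboolP => [[] /asboolP | [H | H]]; first exact: FlatFHT.
- exact: ImbricatedFHT.
- by move=> fH; left; apply/asboolP.
- by move=> iH; right; apply/asboolP.
Qed.

(** * The multiset of classes of the summands *)

Lemma map_rep_codom (T : finType) K (F : 'I_K.+1 -> hypergraph T) :
  map (@rep T) (codom F) = [tuple rep (F k) | k < K.+1].
Proof. by rewrite codomE -map_comp. Qed.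

(** An isomorphism carries one decomposition to a decomposition of the other sum,
    where it is unique. Conversely, a permutation matching the classes lets the
    isomorphisms of the summands be glued. *)
Lemma hiso_hsumP (T : finType) K K' (F : 'I_K.+1 -> hypergraph T)
    (F' : 'I_K'.+1 -> hypergraph T) :
  decomposition F -> decomposition F' ->
  hiso (hsum F) (hsum F') <->
  perm_eq (map (@rep T) (codom F)) (map (@rep T) (codom F')).
Proof.
move=> DF DF'; split=> [/hisoP[f fI FF'] | pF].
  have fIk k : {in hverts (F k) &, injective f}.
    by move=> x y xk yk; apply: fI; apply: (subsetP (hverts_hsum_sup F k)).
  have -> : map (@rep T) (codom F) = map (@rep T) (codom (fun k => hmap f (F k))).
    rewrite !codomE -!map_comp; apply: eq_map => k /=.
    exact/rep_eq/hiso_hmap.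
  apply: perm_map; apply: decomposition_unique => //.
    exact: decomposition_hmap.
  by rewrite -hmap_hsum.
have eqK : K = K'.
  by have := perm_size pF; rewrite !map_rep_codom !size_tuple => -[].
rewrite -{}eqK {K'} in F' DF' pF *; move: pF; rewrite !map_rep_codom.
case/tuple_permP => p pF; rewrite -(hsum_perm F' p).
have [[_ dF _] [_ dF' _]] := (DF, DF'); apply: hiso_hsum => // [i j ij | k].
  by apply: dF'; rewrite (inj_eq perm_inj).
apply/rep_eq; have := congr1 (fun s => nth (rep (F k)) s k) pF.
by rewrite -!tnth_nth !tnth_mktuple.
Qed.

(** Disjoint copies of the prescribed summands, in a product with the index
    set, give an imbricated structure with the prescribed classes. *)
Lemma decomposition_exists v (s : seq (hypergraph 'I_v)) :
  (forall G, G \in s -> fht G) ->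
  proper_partition v [seq #|hverts G| | G <- s] ->
  exists K (F : 'I_K.+1 -> hypergraph 'I_v),
    [/\ decomposition F, hverts (hsum F) = [set: 'I_v]
      & map (@rep 'I_v) (codom F) = map (@rep 'I_v) s].
Proof.
case: s => [|G0 s] fs ps; first by case/and4P: ps.
pose K := size s; pose g (k : 'I_K.+1) := tnth (in_tuple (G0 :: s)) k.
have codomg : codom g = G0 :: s by rewrite codomE map_tnth_enum.
(* Pairing with the index makes the copies disjoint. *)
pose tag k (x : 'I_v) := (k : 'I_K.+1, x).
have tagI k (V : {set 'I_v}) : {in V &, injective (tag k)} by move=> x y _ _ [].
pose F k := hmap (tag k) (g k).
have dF : disjoint_family F.
  move=> i j ij; apply/pred0P => -[k x] /=; apply/negP => /andP[].
  case/imsetP=> y _ [ki _] /imsetP[z _ [kj _]].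
  by rewrite -ki -kj eqxx in ij.
have sizeF : [seq #|hverts (F k)| | k <- enum 'I_K.+1] =
             [seq #|hverts G| | G <- G0 :: s].
  rewrite -codomg codomE -map_comp; apply: eq_map => k /=.
  exact: card_in_imset.
have VF : #|hverts (hsum F)| = v.
  by rewrite card_hverts_hsum // sizeF; have /and4P[_ /eqP] := ps.
have DF : decomposition F.
  split=> //; last by rewrite sizeF VF.
  move=> k; apply: fht_hiso (hiso_hmap (tagI k _)) _; apply: fs.
  by rewrite -codomg codom_f.
have [H HV /hisoP[f fI HE]] := hiso_ord VF.
rewrite HE hmap_hsum // in HV.
exists K, (fun k => hmap f (F k)); split=> //; first exact: decomposition_hmap.
rewrite -codomg !codomE -!map_comp; apply: eq_map => k /=.
symmetry; apply/rep_eq/(hiso_trans (hiso_hmap (tagI k _)))/hiso_hmap.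
by move=> x y xk yk; apply: fI; apply: (subsetP (hverts_hsum_sup F k)).
Qed.

(** Ranging over all decompositions avoids a choice; by uniqueness there is
    essentially one. *)
Definition summands (T : finType) (H : hypergraph T) : {set hypergraph T} :=
  [set G | `[< exists K (F : 'I_K.+1 -> hypergraph T),
                 [/\ decomposition F, hsum F = H & G \in codom F] >]].

Lemma perm_summands (T : finType) K (F : 'I_K.+1 -> hypergraph T) :
  decomposition F -> perm_eq (enum (summands (hsum F))) (codom F).
Proof.
move=> DF; have [_ dF _] := DF.
apply: uniq_perm; [exact: enum_uniq | exact/injectiveP/disjoint_family_inj |].
move=> G; rewrite mem_enum inE; apply/asboolP/idP => [[K' [F' [DF' FF']]] | GF].
  by rewrite (perm_mem (decomposition_unique DF' DF FF')).
by exists K, F.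
Qed.

(** * Bounded sequences as integer partitions *)

Lemma parts_inj v : injective (@parts v).
Proof. by move=> l l' /(inj_map val_inj) ll'; apply: val_inj. Qed.

Lemma size_le_sumn s : all (leq 1) s -> size s <= sumn s.
Proof.
by elim: s => //= x s IH /andP[x0 /IH]; rewrite -add1n; apply: leq_add.
Qed.

Lemma parts_surj v s : proper_partition v s -> exists l, @parts v l = s.
Proof.
case/and4P=> _ /eqP sv _ /allP s_lt.
have sz : size [seq inord w : 'I_v.+1 | w <- s] <= v.
  rewrite size_map -sv size_le_sumn //; apply/allP => w /s_lt /andP[//].
exists (Bseq sz); rewrite /parts /= -map_comp map_id_in // => w /s_lt /andP[_ wv].
by rewrite /= inordK // ltnS ltnW.
Qed.

Lemma geq_sorted_eq s t : sorted geq s -> sorted geq t -> perm_eq s t -> s = t.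
Proof.
apply: sorted_eq => [y x z /= xy yz | x y /=]; first exact: leq_trans yz xy.
by rewrite andbC -eqn_leq => /eqP.
Qed.

(** * Counting imbricated structures *)

Definition class_multiset v (H : hypergraph 'I_v) :
    {ffun hypergraph 'I_v -> 'I_v.+1} :=
  multiplicity v (map (@rep 'I_v) (enum (summands H))).

Lemma class_multiset_hsum v K (F : 'I_K.+1 -> hypergraph 'I_v) :
  decomposition F ->
  class_multiset (hsum F) = multiplicity v (map (@rep 'I_v) (codom F)).
Proof. by move=> DF; apply/perm_multiplicity/perm_map/perm_summands. Qed.

Lemma size_map_rep_codom v K (F : 'I_K.+1 -> hypergraph 'I_v) :
  decomposition F -> hverts (hsum F) = [set: 'I_v] ->
  size (map (@rep 'I_v) (codom F)) <= v.
Proof.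
case=> _ _ + FV; rewrite FV cardsT card_ord => /and4P[_ /eqP sv _ /allP s_lt].
rewrite map_rep_codom size_tuple -[X in _ <= X]sv.
apply: leq_trans (size_le_sumn _); first by rewrite size_map size_enum_ord.
by apply/allP => w /s_lt/andP[].
Qed.

Lemma num_imbricated_multisets v :
  num_imbricated v =
  #|[set class_multiset H | H in [set H : hypergraph 'I_v |
      (hverts H == [set: 'I_v]) && `[< imbricated H >]]]|.
Proof.
apply: card_equivalence_partition => G H; rewrite !inE.
case/andP=> /eqP GV /asboolP/imbricatedP[K [F [DF GE]]].
case/andP=> /eqP HV /asboolP/imbricatedP[K' [F' [DF' HE]]].
rewrite {}GE {}HE in GV HV *; rewrite !class_multiset_hsum //.
apply/asboolP/eqP => [/hiso_hsumP pF | /multiplicity_perm pF].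
  exact/perm_multiplicity/pF.
by apply/hiso_hsumP => //; apply: pF; apply: size_map_rep_codom.
Qed.

Definition size_index v (G : hypergraph 'I_v) : 'I_v.+1 := inord #|hverts G|.

Lemma size_indexE v (G : hypergraph 'I_v) : size_index G = #|hverts G| :> nat.
Proof. by rewrite inordK // ltnS -[X in _ <= X](card_ord v) max_card. Qed.

(** The multisets of classes of FHTs whose sizes are the parts of [l]. *)
Definition size_profile v (l : v.-bseq 'I_v.+1) :
    {set {ffun hypergraph 'I_v -> 'I_v.+1}} :=
  [set M : {ffun hypergraph 'I_v -> 'I_v.+1} |
      [forall G, (G \notin fht_reps 'I_v) ==> (M G == ord0)]
    & [forall i : 'I_v.+1,
        \sum_(G in fht_reps 'I_v | size_index G == i) (M G : nat) ==
        count_mem (i : nat) (parts l)]].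

(** The multiplicities of a sequence of representatives add up, size by size,
    to the multiplicities of the sequence of their sizes. *)
Lemma mem_size_profile v (M : {ffun hypergraph 'I_v -> 'I_v.+1}) t l :
  (forall G, count_mem G t = M G) ->
  (M \in size_profile l) =
  all (mem (fht_reps 'I_v)) t && perm_eq [seq #|hverts G| | G <- t] (parts l).
Proof.
move=> tM; rewrite inE.
have -> : [forall G, (G \notin fht_reps 'I_v) ==> (M G == ord0)] =
          all (mem (fht_reps 'I_v)) t.
  apply/forallP/allP => [M0 G | trep G].
    apply: contraLR => /(implyP (M0 G))/eqP MG.
    by apply/count_memPn; rewrite tM MG.
  apply/implyP => GX; apply/eqP/val_inj; rewrite /= -tM.
  by apply/count_memPn; apply: contra GX => /trep.
apply: andb_id2l => /allP trep.
have sumE (i : 'I_v.+1) :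
    \sum_(G in fht_reps 'I_v | size_index G == i) (M G : nat) =
    count_mem (i : nat) [seq #|hverts G| | G <- t].
  under eq_bigr => G _ do rewrite -tM.
  rewrite sum_count_mem count_map; apply: eq_in_count => G /trep /= ->.
  by rewrite -(inj_eq val_inj) /= size_indexE.
apply/forallP/idP => [Mm | /seq.permP st i]; last by rewrite sumE st.
apply/allP => w wst /=.
have wv : w < v.+1.
  move: wst; rewrite mem_cat => /orP[/mapP[G _ ->] | /mapP[i _ ->]] //.
  by rewrite ltnS -[X in _ <= X](card_ord v) max_card.
by have := Mm (Ordinal wv); rewrite sumE.
Qed.

(** The sequence of summands behind a multiset is sorted by decreasing size, as
    the definition of imbricated structures requires. *)
Lemma class_multiset_image v :
  [set class_multiset H | H in [set H : hypergraph 'I_v |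
      (hverts H == [set: 'I_v]) && `[< imbricated H >]]] =
  \bigcup_(l : v.-bseq 'I_v.+1 | proper_partition v (parts l)) size_profile l.
Proof.
apply/setP => M; apply/imsetP/bigcupP => [[H] | [l pl Ml]].
  rewrite inE => /andP[/eqP HV /asboolP/imbricatedP[K [F [DF HE]]]] ->.
  rewrite {}HE in HV *; rewrite class_multiset_hsum //.
  have [fF _ pF] := DF; rewrite HV cardsT card_ord in pF.
  have [l lE] := parts_surj pF; exists l; first by rewrite lE.
  rewrite (@mem_size_profile _ _ (map (@rep 'I_v) (codom F))); last first.
    by move=> G; rewrite multiplicityE ?size_map_rep_codom.
  apply/andP; split.
    apply/allP => _ /mapP[_ /codomP[k ->] ->]; rewrite /= inE rep_id eqxx.
    exact/asboolP/(fht_hiso (hiso_rep _)).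
  rewrite (_ : map _ _ = parts l) // lE codomE -!map_comp.
  by apply: eq_map => k /=; rewrite -(card_hiso (hiso_rep _)).
have [t tM] := multiplicity_surj (fun G => M G : nat).
rewrite (mem_size_profile _ tM) in Ml; have /andP[/allP trep tl] := Ml.
pose larger (G H : hypergraph 'I_v) := #|hverts H| <= #|hverts G|.
have larger_total : total larger by move=> G H; apply: leq_total.
pose s := sort larger t.
have sl : [seq #|hverts G| | G <- s] = parts l.
  apply: geq_sorted_eq.
  - by rewrite sorted_map; apply: sort_sorted.
  - by have /and4P[] := pl.
  - by apply: perm_trans tl; apply: perm_map; rewrite perm_sort.
have srep G : G \in s -> rep G = G /\ fht G.
  by rewrite mem_sort => /trep; rewrite /= inE => /andP[/eqP-> /asboolP].
have [|| K [F [DF FV Fs]]] := @decomposition_exists v s.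
- by move=> G /srep[].
- by rewrite sl.
exists (hsum F).
  by rewrite inE FV eqxx; apply/asboolP/imbricatedP; exists K, F.
rewrite class_multiset_hsum // Fs map_id_in; last by move=> G /srep[].
apply/ffunP => G; apply: val_inj; rewrite /= multiplicityE -?tM.
  by apply/seq.permP; rewrite perm_sym perm_sort.
by rewrite -(size_map (fun G => #|hverts G|)) sl size_map size_bseq.
Qed.

(** A partition is written in descending order, so the multiset of its parts
    determines it. *)
Lemma size_profile_disjoint v (l l' : v.-bseq 'I_v.+1) M :
  proper_partition v (parts l) -> proper_partition v (parts l') ->
  M \in size_profile l -> M \in size_profile l' -> l = l'.
Proof.
have [t tM] := multiplicity_surj (fun G => M G : nat).
rewrite !(mem_size_profile _ tM) => /and4P[sl _ _ _] /and4P[sl' _ _ _].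
move=> /andP[_ tl] /andP[_ tl']; apply/parts_inj/geq_sorted_eq => //.
by apply: perm_trans tl'; rewrite perm_sym.
Qed.

Lemma card_size_profile v (l : v.-bseq 'I_v.+1) :
  #|size_profile l| =
  \prod_(s <- undup (parts l))
    'C(num_fht s + count_mem s (parts l) - 1, count_mem s (parts l)).
Proof.
have mv (i : 'I_v.+1) : count_mem (i : nat) (parts l) <= v.
  by rewrite (leq_trans (count_size _ _)) // size_map size_bseq.
rewrite [LHS](card_coloured_multisets (fht_reps 'I_v) (@size_index v) mv).
rewrite undup_map_inj; last exact: val_inj.
rewrite big_map [RHS]big_uniq ?undup_uniq //= [RHS]big_mkcond /=.
apply: eq_bigr => i _; rewrite mem_undup (@num_fht_rep i v) -1?ltnS //.
case: ifPn => [_ | il]; last first.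
  by rewrite (count_memPn _) ?bin0 // mem_map //; apply: val_inj.
congr 'C(_ + _ - 1, _); apply: eq_card => G.
by rewrite !inE -[_ == i](inj_eq val_inj) /= size_indexE.
Qed.

Theorem theorem2p4p1 (v : nat) (hv : 2 < v) :
  num_imbricated v =
  \sum_(l : v.-bseq 'I_v.+1 | proper_partition v (parts l))
    \prod_(s <- undup (parts l))
      'C(num_fht s + count_mem s (parts l) - 1, count_mem s (parts l)).
Proof.
rewrite num_imbricated_multisets class_multiset_image big_mkcond /=.
rewrite -sum1_card partition_disjoint_bigcup => [|l l' ll'].
  rewrite [RHS]big_mkcond /=; apply: eq_bigr => l _.
  by case: ifP => _; rewrite ?big_set0 // sum1_card card_size_profile.
apply/pred0P => M /=; apply/negP => /andP[].
do 2![case: ifP => [?|_]; last by rewrite in_set0].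
by move=> Ml Ml'; case/eqP: ll'; apply: size_profile_disjoint Ml Ml'.
Qed.
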